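(* Let $n,m,k$ be positive integers with $k\le m$, let $\bar{\mathbf a}=(\bar{\mathbf a}^1,\dots,\bar{\mathbf a}^m)\in\mathbb R^{n\times m}$ be such that $\bar{\mathbf a}^1,\dots,\bar{\mathbf a}^m$ are pairwise distinct, and let $F_1:\mathbb R^{n\times m}\rightrightarrows\mathbb R^{n\times k}$ be the local solution map defined in the context. Let $\bar{\mathbf x}=(\bar{\mathbf x}^1,\dots,\bar{\mathbf x}^k)\in F_1(\bar{\mathbf a})$ be such that $\bar{\mathbf x}^{j_1}\neq\bar{\mathbf x}^{j_2}$ whenever $j_2\ne j_1$. Then $F_1$ has the Aubin property at $(\bar{\mathbf a},\bar{\mathbf x})$, i.e., there exist $L_1>0$, $\varepsilon>0$ and $\delta_1>0$ such that $$F_1(\mathbf a)\cap B(\bar{\mathbf x},\varepsilon)\subset F_1(\widetilde{\mathbf a})+L_1\|\mathbf a-\widetilde{\mathbf a}\|\,\bar B_{\mathbb R^{n\times k}}$$ for all $\mathbf a,\widetilde{\mathbf a}\in\mathbb R^{n\times m}$ satisfying $\|\mathbf a-\bar{\mathbf a}\|<\delta_1$ and $\|\widetilde{\mathbf a}-\bar{\mathbf a}\|<\delta_1$.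
   Context: $\mathbb R^n$ carries the Euclidean norm. Elements of $\mathbb R^{n\times m}$ are written $\mathbf a=({\mathbf a}^1,\dots,{\mathbf a}^m)$ with ${\mathbf a}^i\in\mathbb R^n$, and elements of $\mathbb R^{n\times k}$ are written $\mathbf x=({\mathbf x}^1,\dots,{\mathbf x}^k)$ with ${\mathbf x}^j\in\mathbb R^n$. These product spaces are equipped with the sum norms $\|\mathbf a\|=\sum_{i=1}^m\|{\mathbf a}^i\|$ and $\|\mathbf x\|=\sum_{j=1}^k\|{\mathbf x}^j\|$. $B(\bar{\mathbf x},\varepsilon)$ is the open ball in $\mathbb R^{n\times k}$ with center $\bar{\mathbf x}$ and radius $\varepsilon$, and $\bar B_{\mathbb R^{n\times k}}$ is the closed unit ball of $\mathbb R^{n\times k}$. Put $$f(\mathbf x,\mathbf a)=\frac1m\sum_{i=1}^m\Big(\min_{j=1,\dots,k}\|{\mathbf a}^i-{\mathbf x}^j\|^2\Big).$$ The local solution map assigns to $\mathbf a\in\mathbb R^{n\times m}$ the set $F_1(\mathbf a)$ of all local minimizers over $\mathbb R^{n\times k}$ of the function $\mathbf x\mapsto f(\mathbf x,\mathbf a)$. *)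

(* Defs.v *)
From mathcomp Require Import all_boot all_order all_algebra.
From mathcomp Require Import all_classical all_reals.

Set Implicit Arguments.
Unset Strict Implicit.
Unset Printing Implicit Defensive.

Import Order.TTheory GRing.Theory Num.Theory.
Local Open Scope classical_set_scope.
Local Open Scope ring_scope.

(* An element a = (a^1, ..., a^m) of R^(n x m) is a matrix 'M[R]_(n, m) whose
   i-th column [col i a] is a^i. The norms are defined here because the norm
   that MathComp-Analysis puts on matrices is the maximum norm. *)

Definition enorm (R : realType) (n : nat) (v : 'cV[R]_n) : R :=
  Num.sqrt (\sum_(i < n) v i 0 ^+ 2).

Definition sumnorm (R : realType) (n m : nat) (a : 'M[R]_(n, m)) : R :=
  \sum_(i < m) enorm (col i a).

Definition sball (R : realType) (n k : nat) (xbar : 'M[R]_(n, k)) (eps : R) :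
    set 'M[R]_(n, k) :=
  [set x | sumnorm (x - xbar) < eps].

Definition closed_unit_sball (R : realType) (n k : nat) : set 'M[R]_(n, k) :=
  [set x | sumnorm x <= 1].

(* The minimum over j is the infimum of a finite set of reals, nonempty when
   0 < k; [min_sqdist_attained] and [min_sqdist_le] below show that it is then
   a minimum. For k = 0 the value is the junk value 0. *)
Definition min_sqdist (R : realType) (n k : nat)
    (v : 'cV[R]_n) (x : 'M[R]_(n, k)) : R :=
  inf (range (fun j : 'I_k => enorm (v - col j x) ^+ 2)).

Definition clustering_obj (R : realType) (n m k : nat)
    (x : 'M[R]_(n, k)) (a : 'M[R]_(n, m)) : R :=
  m%:R^-1 * \sum_(i < m) min_sqdist (col i a) x.

Definition local_minimizers (R : realType) (n k : nat)
    (g : 'M[R]_(n, k) -> R) : set 'M[R]_(n, k) :=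
  [set x | exists2 r : R, 0 < r & forall y, sball x r y -> g x <= g y].

Definition local_solution_map (R : realType) (n m k : nat)
    (a : 'M[R]_(n, m)) : set 'M[R]_(n, k) :=
  local_minimizers (fun x => clustering_obj x a).

Definition aubin_property (R : realType) (n m k : nat)
    (F : 'M[R]_(n, m) -> set 'M[R]_(n, k))
    (abar : 'M[R]_(n, m)) (xbar : 'M[R]_(n, k)) : Prop :=
  exists L eps delta : R,
    [/\ 0 < L, 0 < eps, 0 < delta &
      forall a a' : 'M[R]_(n, m),
        sumnorm (a - abar) < delta -> sumnorm (a' - abar) < delta ->
        F a `&` sball xbar eps `<=`
          [set y + (L * sumnorm (a - a')) *: b
            | y in F a' & b in @closed_unit_sball R n k]].

Lemma min_sqdist_le (R : realType) (n k : nat)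
    (v : 'cV[R]_n) (x : 'M[R]_(n, k)) (j : 'I_k) :
  min_sqdist v x <= enorm (v - col j x) ^+ 2.
Proof.
apply: ge_inf; last by exists j.
by exists 0 => _ [i _ <-]; rewrite sqr_ge0.
Qed.

Lemma min_sqdist_attained (R : realType) (n k : nat)
    (v : 'cV[R]_n) (x : 'M[R]_(n, k)) :
  (0 < k)%N -> exists j : 'I_k, min_sqdist v x = enorm (v - col j x) ^+ 2.
Proof.
move=> k0; pose d (j : 'I_k) := enorm (v - col j x) ^+ 2.
have [j _ jmin] := @arg_minP _ _ _ (Ordinal k0) xpredT d isT.
exists j; apply/eqP; rewrite eq_le min_sqdist_le /=.
by apply: lb_le_inf; [exists (d j), j | move=> _ [i _ <-]; exact: jmin].
Qed.

(* Main.v *)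
Require Import Defs.
From mathcomp Require Import all_boot all_order all_algebra.
From mathcomp Require Import all_classical all_reals.
From mathcomp Require Import ring lra.

Set Implicit Arguments.
Unset Strict Implicit.
Unset Printing Implicit Defensive.

Import Order.TTheory GRing.Theory Num.Theory.
Local Open Scope classical_set_scope.
Local Open Scope ring_scope.

(** The objective is a minimum of smooth functions: for an assignment [s] of the
    data points to the centers, [assigned_cost s] is a quadratic function of
    the centers, and the objective is, up to the factor 1/m, the least of these
    costs, attained when every point goes to a nearest center.

    A local minimizer of the objective is therefore a local minimizer, hence a
    stationary point, of [assigned_cost s] for each nearest assignment [s]: a
    center with a nonempty cluster is the mean of that cluster
    ([local_solution_residual]).  When the centers are distinct, a tie between
    two centers would make the same center the mean of its cluster with and
    without the tied data point, so this point would coincide with both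
    centers, which is absurd.  The nearest assignment is thus unique at the
    reference solution, with strict inequalities
    ([local_solution_strictly_nearest]), and so it remains the unique nearest
    one for all nearby centers and data ([strictly_nearest_open]).

    In such a neighborhood the objective is one convex quadratic function of
    the centers, and its local minimizers are exactly the configurations whose
    nonempty clusters have their means as centers, the centers of empty
    clusters being free.  Given a local minimizer x for the data a, the
    translation of every center by the displacement of its cluster mean between
    a and b gives a local minimizer for b ([residual_mean_shift]).  Taking means
    does not increase the sum norm ([sumnorm_mean_shift]), so the Aubin property
    holds with modulus 1. *)

(** * The Euclidean norm *)

Section EuclideanNorm.
Context {R : realType} {n : nat}.
Implicit Types u v w : 'cV[R]_n.

Definition dot u v : R := (u^T *m v) 0 0.

Lemma dotE u v : dot u v = \sum_l u l 0 * v l 0.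
Proof. by rewrite /dot mxE; apply: eq_bigr => l _; rewrite mxE. Qed.

Lemma dotC u v : dot u v = dot v u.
Proof. by rewrite !dotE; apply: eq_bigr => l _; rewrite mulrC. Qed.

Lemma dotDr u v w : dot u (v + w) = dot u v + dot u w.
Proof. by rewrite /dot mulmxDr mxE. Qed.

Lemma dotNr u v : dot u (- v) = - dot u v.
Proof. by rewrite /dot mulmxN mxE. Qed.

Lemma dotZr c u v : dot u (c *: v) = c * dot u v.
Proof. by rewrite /dot -scalemxAr mxE. Qed.

Lemma dotDl u v w : dot (v + w) u = dot v u + dot w u.
Proof. by rewrite dotC dotDr !(dotC u). Qed.

Lemma dotNl u v : dot (- v) u = - dot v u.
Proof. by rewrite dotC dotNr dotC. Qed.

Lemma dotZl c u v : dot (c *: v) u = c * dot v u.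
Proof. by rewrite dotC dotZr dotC. Qed.

Lemma dot_sumr (I : finType) (P : pred I) u (F : I -> 'cV[R]_n) :
  dot u (\sum_(i | P i) F i) = \sum_(i | P i) dot u (F i).
Proof. by rewrite /dot mulmx_sumr summxE. Qed.

Lemma dot_ge0 u : 0 <= dot u u.
Proof. by rewrite dotE sumr_ge0 // => l _; rewrite -expr2 sqr_ge0. Qed.

Lemma dot_eq0 u : (dot u u == 0) = (u == 0).
Proof.
apply/eqP/eqP => [|->]; last by rewrite /dot mulmx0 mxE.
rewrite dotE => /eqP; rewrite psumr_eq0 => [/allP u0|l _]; last first.
  by rewrite -expr2 sqr_ge0.
apply/matrixP => l j; rewrite ord1 mxE; apply/eqP.
by have := u0 l (mem_index_enum _); rewrite mulf_eq0 orbb.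
Qed.

Lemma sqr_enorm u : enorm u ^+ 2 = dot u u.
Proof.
have E : \sum_(l < n) u l 0 ^+ 2 = dot u u.
  by rewrite dotE; apply: eq_bigr => l _; rewrite expr2.
by rewrite /enorm E sqr_sqrtr // dot_ge0.
Qed.

Lemma enorm_ge0 u : 0 <= enorm u.
Proof. exact: sqrtr_ge0. Qed.

Lemma enorm_eq0 u : (enorm u == 0) = (u == 0).
Proof. by rewrite -dot_eq0 -sqr_enorm sqrf_eq0. Qed.

Lemma enorm0 : enorm (0 : 'cV[R]_n) = 0.
Proof. by apply/eqP; rewrite enorm_eq0. Qed.

Lemma enormZ c u : enorm (c *: u) = `|c| * enorm u.
Proof.
apply/eqP; rewrite -(@eqrXn2 _ 2) ?mulr_ge0 ?enorm_ge0 //.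
by rewrite exprMn !sqr_enorm dotZl dotZr real_normK ?num_real // expr2 mulrA.
Qed.

Lemma enormN u : enorm (- u) = enorm u.
Proof. by rewrite -scaleN1r enormZ normrN1 mul1r. Qed.

(** Expansion of the square of |v| u - |u| v, whose two outer terms are equal;
    the factor |u| |v| then cancels. *)
Lemma CauchySchwarz u v : dot u v <= enorm u * enorm v.
Proof.
have [->|v0] := eqVneq v 0.
  by rewrite enorm0 mulr0 /dot mulmx0 mxE.
have nv : 0 < enorm v by rewrite lt_def enorm_eq0 v0 enorm_ge0.
have [->|u0] := eqVneq u 0.
  by rewrite enorm0 mul0r /dot trmx0 mul0mx mxE.
have nu : 0 < enorm u by rewrite lt_def enorm_eq0 u0 enorm_ge0.
have := dot_ge0 (enorm v *: u - enorm u *: v).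
rewrite !(dotDl, dotDr, dotNl, dotNr, dotZl, dotZr) -!sqr_enorm (dotC v u).
set s := enorm u in nu *; set t := enorm v in nv *; set d := dot u v => H.
have: 0 <= (s * t) * (s * t - d) by lra.
by rewrite pmulr_rge0 ?mulr_gt0 // subr_ge0.
Qed.

Lemma enormD u v : enorm (u + v) <= enorm u + enorm v.
Proof.
rewrite -(@ler_pXn2r _ 2) ?nnegrE ?addr_ge0 ?enorm_ge0 //.
rewrite sqrrD !sqr_enorm !(dotDl, dotDr) (dotC v u).
have := CauchySchwarz u v; lra.
Qed.

Lemma enorm_sum (I : finType) (P : pred I) (F : I -> 'cV[R]_n) :
  enorm (\sum_(i | P i) F i) <= \sum_(i | P i) enorm (F i).
Proof.
elim/big_ind2: _ => [|x1 x2 y1 y2 h1 h2|//]; first by rewrite enorm0.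
exact: le_trans (enormD _ _) (lerD h1 h2).
Qed.

End EuclideanNorm.

(** * The sum norm *)

Section SumNorm.
Context {R : realType} {n p : nat}.
Implicit Types x y : 'M[R]_(n, p).

Lemma enorm_col_le x j : enorm (col j x) <= sumnorm x.
Proof.
by rewrite /sumnorm (bigD1 j) //= lerDl sumr_ge0 // => i _; exact: enorm_ge0.
Qed.

Lemma sumnorm_ge0 x : 0 <= sumnorm x.
Proof. by apply: sumr_ge0 => i _; exact: enorm_ge0. Qed.

Lemma sumnormD x y : sumnorm (x + y) <= sumnorm x + sumnorm y.
Proof.
rewrite /sumnorm -big_split /=; apply: ler_sum => i _.
by rewrite [col i _]linearD enormD.
Qed.

Lemma sumnormZ c x : sumnorm (c *: x) = `|c| * sumnorm x.
Proof.
rewrite /sumnorm mulr_sumr; apply: eq_bigr => i _.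
by rewrite [col i _]linearZ enormZ.
Qed.

Lemma sumnormN x : sumnorm (- x) = sumnorm x.
Proof. by rewrite -scaleN1r sumnormZ normrN1 mul1r. Qed.

Lemma sumnorm_le0 x : sumnorm x <= 0 -> x = 0.
Proof.
move=> x0; apply/matrixP => l j; rewrite mxE.
have : enorm (col j x) == 0.
  by rewrite eq_le enorm_ge0 andbT (le_trans (enorm_col_le _ _)).
by rewrite enorm_eq0 => /eqP/colP/(_ l); rewrite !mxE.
Qed.

(** The scaling in the definition of the Aubin property: a displacement of
    norm at most c lies in c times the unit ball, also for c = 0, when the
    displacement vanishes. *)
Lemma scaled_unit_ball c x :
  sumnorm x <= c -> exists2 b, closed_unit_sball b & x = c *: b.
Proof.
move=> xc; have c0 := le_trans (sumnorm_ge0 x) xc.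
have [c_eq0|c_neq0] := eqVneq c 0.
  exists 0; last by rewrite scaler0; apply: sumnorm_le0; rewrite -c_eq0.
  by rewrite /closed_unit_sball /= -(scale0r 0) sumnormZ normr0 mul0r ler01.
exists (c^-1 *: x); last by rewrite scalerA divff // scale1r.
rewrite /closed_unit_sball /= sumnormZ ger0_norm ?invr_ge0 //.
by rewrite mulrC ler_pdivrMr ?mul1r // lt_def c_neq0.
Qed.

End SumNorm.

(** * Assignments of data points to centers *)

Section Assignment.
Context {R : realType} {n m k : nat}.
Implicit Types (a : 'M[R]_(n, m)) (x y h : 'M[R]_(n, k)) (s : 'I_m -> 'I_k).

Definition assigned_cost s x a : R :=
  \sum_(i < m) enorm (col i a - col (s i) x) ^+ 2.

Definition nearest s x a : Prop :=
  forall i j, enorm (col i a - col (s i) x) <= enorm (col i a - col j x).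

Definition strictly_nearest s x a : Prop :=
  forall i j, j != s i ->
    enorm (col i a - col (s i) x) < enorm (col i a - col j x).

Definition cluster_size s (j : 'I_k) : nat := #|[pred i | s i == j]|.

(** Half the opposite of the gradient of [assigned_cost s] at [x].  Its column
    [j] vanishes when the cluster [j] is empty or has mean [col j x]. *)
Definition residual s x a : 'M[R]_(n, k) :=
  \matrix_(l, j) \sum_(i < m | s i == j) (a l i - x l j).

Lemma strictly_nearestW s x a : strictly_nearest s x a -> nearest s x a.
Proof.
by move=> sN i j; have [->//|ji] := eqVneq j (s i); apply/ltW/sN.
Qed.

Lemma clustering_obj_le s x a :
  clustering_obj x a <= m%:R^-1 * assigned_cost s x a.
Proof.
rewrite ler_wpM2l ?invr_ge0 ?ler0n //.
by apply: ler_sum => i _; exact: min_sqdist_le.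
Qed.

Lemma clustering_obj_nearest s x a :
  nearest s x a -> clustering_obj x a = m%:R^-1 * assigned_cost s x a.
Proof.
move=> sN; congr (_ * _); apply: eq_bigr => i _; apply/eqP.
rewrite eq_le min_sqdist_le /=.
have k0 : (0 < k)%N by case: (s i) => /= ? /(leq_ltn_trans (leq0n _)).
have [j ->] := min_sqdist_attained (col i a) x k0.
by rewrite ler_pXn2r ?nnegrE ?enorm_ge0.
Qed.

Lemma nearest_exists x a : (0 < k)%N -> exists s, nearest s x a.
Proof.
move=> k0; pose d i j := enorm (col i a - col j x).
exists (fun i => [arg min_(j < Ordinal k0) d i j]%O) => i j.
by case: arg_minP => //= j' _; exact.
Qed.

Lemma col_residual s x a j :
  col j (residual s x a) = \sum_(i < m | s i == j) (col i a - col j x).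
Proof.
by apply/colP => l; rewrite !mxE summxE; apply: eq_bigr => i _; rewrite !mxE.
Qed.

(** The parallel axis theorem, cluster by cluster, or the exact second-order
    expansion of a quadratic function. *)
Lemma assigned_costD s x h a :
  assigned_cost s (x + h) a = assigned_cost s x a +
    \sum_(j < k) ((cluster_size s j)%:R * dot (col j h) (col j h)
                  - 2 * dot (col j h) (col j (residual s x a))).
Proof.
rewrite /assigned_cost (partition_big s xpredT) //=.
rewrite [in RHS](partition_big s xpredT) //= -big_split /=.
apply: eq_bigr => j _; rewrite col_residual dot_sumr mulr_sumr.
rewrite mulr_natl -sumr_const -sumrB -big_split /=.
apply: eq_bigr => i /eqP ->; rewrite [col j (x + h)]linearD /= !sqr_enorm.
rewrite !(dotDl, dotDr, dotNl, dotNr) !(dotC _ (col j h)) !(dotC (col j x)).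
ring.
Qed.

(** At a zero of the residual the linear term of the expansion vanishes and the
    quadratic one is nonnegative. *)
Lemma residual0_min s x y a :
  residual s x a = 0 -> assigned_cost s x a <= assigned_cost s y a.
Proof.
move=> r0; rewrite -[y](subrKC x) assigned_costD r0 lerDl sumr_ge0 // => j _.
by rewrite [col j 0]linear0 [dot _ 0]dotE big1 => [|l _]; rewrite ?mxE ?mulr0 //
  subr0 mulr_ge0 ?dot_ge0 ?ler0n.
Qed.

(** A small gradient step keeps the assignment cost above the objective, which
    it meets at [x].  Local minimality of [x] therefore forbids any decrease
    of this cost, and a nonzero residual would give one. *)
Lemma local_solution_residual s x a : (0 < m)%N ->
  local_solution_map a x -> nearest s x a -> residual s x a = 0.
Proof.
move=> m0 [r r0 xmin] sN; set w := residual s x a.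
have w1 : 0 < sumnorm w + 1 by rewrite ltr_wpDl ?sumnorm_ge0.
(* the first bound keeps the step in the ball, the second makes the quadratic
   term at most half of the linear one, since clusters have at most m points *)
pose t := Num.min (r / (2 * (sumnorm w + 1))) m%:R^-1.
have t0 : 0 < t by rewrite lt_min divr_gt0 ?mulr_gt0 //= invr_gt0 ltr0n.
have tm : t * m%:R <= 1 by rewrite -ler_pdivlMr ?ltr0n // div1r ge_min lexx orbT.
have tw : sumnorm (t *: w) < r.
  rewrite sumnormZ gtr0_norm //.
  have : t <= r / (2 * (sumnorm w + 1)) by rewrite ge_min lexx.
  rewrite ler_pdivlMr ?mulr_gt0 // => H.
  have := sumnorm_ge0 w; nra.
have /= := xmin (x + t *: w); rewrite /sball /= addrAC subrr add0r => /(_ tw).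
rewrite (clustering_obj_nearest sN) => /le_trans/(_ (clustering_obj_le s _ _)).
rewrite ler_pM2l ?invr_gt0 ?ltr0n // assigned_costD lerDl => S.
have D j : (cluster_size s j)%:R * dot (col j (t *: w)) (col j (t *: w))
    - 2 * dot (col j (t *: w)) (col j w) <= - t * dot (col j w) (col j w).
  rewrite [col j (t *: w)]linearZ /= !(dotZl, dotZr).
  have Nm : (cluster_size s j)%:R * t <= 1 :> R.
    rewrite mulrC (le_trans _ tm) // ler_pM2l // ler_nat.
    by rewrite -[leqRHS]card_ord max_card.
  set d := dot _ _; set N := _%:R in Nm *.
  have : 0 <= (1 - N * t) * (t * d).
    by rewrite !mulr_ge0 ?dot_ge0 ?subr_ge0 // ltW.
  lra.
have : \sum_(j < k) (- t * dot (col j w) (col j w)) >= 0.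
  by apply: le_trans S _; apply: ler_sum.
rewrite -mulr_sumr mulNr oppr_ge0 pmulr_rle0 // => W.
apply/matrixP => l j; rewrite [RHS]mxE.
have : dot (col j w) (col j w) == 0.
  rewrite eq_le dot_ge0 andbT (le_trans _ W) // (bigD1 j) //= lerDl.
  by apply: sumr_ge0 => *; exact: dot_ge0.
by rewrite dot_eq0 => /eqP/colP/(_ l); rewrite !mxE.
Qed.

(** As long as [s] remains nearest, the objective is a multiple of
    [assigned_cost s], which a zero of the residual minimizes globally. *)
Lemma strictly_nearest_local_solution s x a r : 0 < r ->
  (forall y, sball x r y -> strictly_nearest s y a) ->
  residual s x a = 0 -> local_solution_map a x.
Proof.
move=> r0 sN res0; exists r => // y xy.
have xx : sball x r x.
  by rewrite /sball /= subrr -(scale0r 0) sumnormZ normr0 mul0r.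
rewrite !(clustering_obj_nearest (strictly_nearestW (sN _ _))) //.
by rewrite ler_wpM2l ?invr_ge0 ?ler0n // residual0_min.
Qed.

(** If [i] had a second nearest center [j], moving [i] from its cluster to that
    of [j] would give another nearest assignment.  Both residuals vanish and
    their columns at [s i] differ by the contribution of [i] alone, so the
    center [s i], and then by equality of distances the center [j], would be
    at the data point [i]. *)
Lemma local_solution_strictly_nearest s x a : (0 < m)%N ->
  (forall j1 j2 : 'I_k, j2 != j1 -> col j1 x != col j2 x) ->
  local_solution_map a x -> nearest s x a -> strictly_nearest s x a.
Proof.
move=> m0 xdist xsol sN i j ji; rewrite lt_neqAle sN andbT.
apply/negP => /eqP eqd.
pose s' i' := if i' == i then j else s i'.
have s'N : nearest s' x a.
  move=> i' j'; rewrite /s'; case: eqP => [->|_]; last exact: sN.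
  by rewrite -eqd.
have := col_residual s' x a (s i); have := col_residual s x a (s i).
rewrite !local_solution_residual // (bigD1 i) //= [col _ 0]linear0.
set S := (X in _ + X) => rs rs'.
have eS : \sum_(i' < m | s' i' == s i) (col i' a - col (s i) x) = S.
  apply: eq_bigl => i'; rewrite /s'; case: (eqVneq i' i) => _ /=; last by rewrite andbT.
  by rewrite andbF (negbTE ji).
rewrite -rs' in eS; rewrite -eS addr0 in rs.
have /eqP : enorm (col i a - col j x) = 0 by rewrite -eqd -rs enorm0.
rewrite enorm_eq0 subr_eq0 => /eqP aj.
by have /negP := xdist _ _ ji; apply; rewrite -aj eq_sym -subr_eq0 -rs.
Qed.

(** Strict nearness amounts to finitely many strict inequalities between
    continuous functions of the centers and the data. *)
Lemma strictly_nearest_open s x a : strictly_nearest s x a ->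
  exists2 eta : R, 0 < eta & forall y b,
    sumnorm (y - x) < eta -> sumnorm (b - a) < eta -> strictly_nearest s y b.
Proof.
move=> sN.
pose gap (p : 'I_m * 'I_k) :=
  enorm (col p.1 a - col p.2 x) - enorm (col p.1 a - col (s p.1) x).
(* each of the two distances in a gap changes by less than 2 eta *)
pose eta := (\big[Num.min/1]_(p | p.2 != s p.1) gap p) / 4.
exists eta => [|y b yx ba i j ji].
  rewrite divr_gt0 //; elim/big_ind: _ => [//|u v u0 v0|[i j] /= ji].
    by rewrite lt_min u0.
  by rewrite subr_gt0 sN.
have gE : 4 * eta <= gap (i, j).
  by rewrite /eta mulrC divfK ?pnatr_eq0 //; exact: (bigmin_le_cond _ (j := (i, j))).
have dist j' : `|enorm (col i b - col j' y) - enorm (col i a - col j' x)|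
    < 2 * eta.
  have bi : enorm (col i (b - a)) < eta.
    exact: le_lt_trans (enorm_col_le _ _) ba.
  have yj : enorm (col j' (y - x)) < eta.
    exact: le_lt_trans (enorm_col_le _ _) yx.
  have E : col i b - col j' y =
      (col i a - col j' x) + (col i (b - a) - col j' (y - x)).
    by apply/colP => l; rewrite !mxE; ring.
  have E' : col i a - col j' x =
      (col i b - col j' y) - (col i (b - a) - col j' (y - x)).
    by rewrite E addrK.
  have := enormD (col i a - col j' x) (col i (b - a) - col j' (y - x)).
  have := enormD (col i b - col j' y) (- (col i (b - a) - col j' (y - x))).
  have := enormD (col i (b - a)) (- col j' (y - x)).
  rewrite -E -E' !enormN ltr_norml => h1 h2 h3; apply/andP; split; lra.
have := dist (s i); have := dist j; rewrite !ltr_norml => /andP[? ?] /andP[? ?].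
rewrite /gap /= in gE; lra.
Qed.

(** Displaces every center as the mean of its cluster is displaced when the
    data change from [a] to [b]; an empty cluster has size 0, whose inverse is
    0, and its center stays put. *)
Definition mean_shift s (a b : 'M[R]_(n, m)) : 'M[R]_(n, k) :=
  \matrix_(l, j) ((cluster_size s j)%:R^-1
                  * \sum_(i < m | s i == j) (b l i - a l i)).

Lemma residual_mean_shift s x a b :
  residual s (x + mean_shift s a b) b = residual s x a.
Proof.
apply/matrixP => l j; rewrite !mxE.
set d := \sum_(i < m | s i == j) (b l i - a l i).
have dE : (cluster_size s j)%:R * ((cluster_size s j)%:R^-1 * d) = d.
  have [N0|N0] := eqVneq (cluster_size s j) 0%N; last first.
    by rewrite mulrA divff ?pnatr_eq0 // mul1r.
  rewrite N0 mul0r /d big_pred0 // => i.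
  exact: (card0_eq N0 i).
rewrite mulr_natl -sumr_const in dE.
under eq_bigr do rewrite opprD addrA.
rewrite sumrB [X in _ - X]dE /d -sumrB.
by apply: eq_bigr => i _; ring.
Qed.

(** A mean is a 1-Lipschitz function of its data for the sum norm, and distinct
    clusters depend on disjoint parts of the data. *)
Lemma sumnorm_mean_shift s a b :
  sumnorm (mean_shift s a b) <= sumnorm (a - b).
Proof.
rewrite -opprB sumnormN /sumnorm [leRHS](partition_big s xpredT) //=.
apply: ler_sum => j _.
have -> : col j (mean_shift s a b) =
    (cluster_size s j)%:R^-1 *: \sum_(i < m | s i == j) col i (b - a).
  apply/colP => l; rewrite !mxE summxE; congr (_ * _).
  by apply: eq_bigr => i _; rewrite !mxE.
rewrite enormZ ger0_norm ?invr_ge0 ?ler0n // (le_trans _ (enorm_sum _ _)) //.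
rewrite ler_piMl ?enorm_ge0 //.
have [->|N0] := posnP (cluster_size s j); first by rewrite invr0 ler01.
by rewrite invf_le1 ?ler1n // ltr0n.
Qed.

End Assignment.

(** * The Aubin property *)

Theorem theorem7 (R : realType) (n m k : nat)
    (hn : (0 < n)%N) (hm : (0 < m)%N) (hk : (0 < k)%N) (hkm : (k <= m)%N)
    (abar : 'M[R]_(n, m))
    (habar : forall i1 i2 : 'I_m, i1 != i2 -> col i1 abar != col i2 abar)
    (xbar : 'M[R]_(n, k))
    (hxbar : @local_solution_map R n m k abar xbar)
    (hdist : forall j1 j2 : 'I_k, j2 != j1 -> col j1 xbar != col j2 xbar) :
  aubin_property (@local_solution_map R n m k) abar xbar.
Proof.
have [s sN] := nearest_exists xbar abar hk.
have sS := local_solution_strictly_nearest hm hdist hxbar sN.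
have [eta eta0 sO] := strictly_nearest_open sS.
(* the shifted center is at most eps + 2 delta from xbar, which leaves room for
   a ball of radius eta / 4 in which the assignment is still s *)
have e4 : 0 < eta / 4 by rewrite divr_gt0.
exists 1, (eta / 4), (eta / 4); split=> // a b aa bb x [xsol xx].
rewrite /sball /= in xx.
have ab : sumnorm (a - b) < eta / 2.
  have -> : a - b = (a - abar) - (b - abar) by rewrite opprB addrA subrK.
  by have := sumnormD (a - abar) (- (b - abar)); rewrite sumnormN; lra.
have res0 : residual s x a = 0.
  apply: local_solution_residual => //; apply/strictly_nearestW/sO; lra.
pose y := x + mean_shift s a b.
have shift := sumnorm_mean_shift s a b.
have [c c1 cE] : exists2 c, closed_unit_sball c &
    - mean_shift s a b = sumnorm (a - b) *: c.
  by apply: scaled_unit_ball; rewrite sumnormN.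
exists y.
  apply: (strictly_nearest_local_solution (s := s) e4); last first.
    by rewrite residual_mean_shift.
  move=> z; rewrite /sball /= => zy; apply: sO; last lra.
  have -> : z - xbar = (z - y) + ((x - xbar) + mean_shift s a b).
    by rewrite /y; apply/matrixP => l j; rewrite !mxE; ring.
  have := sumnormD (z - y) ((x - xbar) + mean_shift s a b).
  have := sumnormD (x - xbar) (mean_shift s a b); lra.
by exists c => //; rewrite mul1r -cE /y addrK.
Qed.
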